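(* Let $n\geqslant 7$ and let $C_n^2$ be the square of the cycle $C_n$ of length $n$. Then $d_{\min}(C_n^2)=\pi_{T}(C_n^2)+1$.
   Context: All graphs are simple. $C_n=v_0v_1\cdots v_{n-1}v_0$ denotes the cycle of length $n$. For a connected graph $G$, its square $G^2$ has vertex set $V(G)$, and two distinct vertices are adjacent in $G^2$ if and only if their distance in $G$ is at most $2$. An orientation of a graph $G$ assigns a direction to each edge; it is acyclic if it contains no directed cycle. In an acyclic orientation $D$ of $G$, an arc is called dependent if reversing it (keeping all other arcs) creates a directed cycle; $d(D)$ denotes the number of dependent arcs of $D$. $d_{\min}(G)$ is the minimum of $d(D)$ over all acyclic orientations $D$ of $G$. For a graph $G$, $\pi_{T}(G)$ denotes the minimum number of edges whose deletion from $G$ yields a triangle-free graph (no subgraph isomorphic to $K_3$). *)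

(* Defs.v *)
From mathcomp Require Import all_boot.

Set Implicit Arguments.
Unset Strict Implicit.
Unset Printing Implicit Defensive.

Record sgraph := SGraph {
  vertex :> finType;
  adj : rel vertex;
  adj_sym : symmetric adj;
  adj_irrefl : irreflexive adj
}.
Arguments adj {s} x y.

Section Graph.
Variable G : sgraph.

Definition edges : {set {set G}} :=
  [set [set p.1; p.2] | p in [pred p : G * G | adj p.1 p.2]].

Definition has_walk (k : nat) (x y : G) : bool :=
  [exists p : k.-tuple G, path adj x p && (last x p == y)].

(* The least length of a walk from x to y. A shortest walk has fewer than #|G|
   edges; when y is not reachable from x, [find] returns the size of the
   list, so the value is #|G|.+1, which exceeds 2 as soon as x != y. *)
Definition dist (x y : G) : nat :=
  find (fun k => has_walk k x y) (iota 0 #|G|.+1).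

Lemma has_walk0 x y : has_walk 0 x y = (x == y).
Proof.
apply/existsP/idP => [[p]|xy]; first by rewrite tuple0.
by exists [tuple].
Qed.

Lemma has_walk_sym k : symmetric (has_walk k).
Proof.
suff imp x y : has_walk k x y -> has_walk k y x.
  by move=> x y; apply/idP/idP; apply: imp.
case/existsP=> p /andP[xp /eqP yE]; apply/existsP.
have sz : size (rev (belast x p)) == k.
  by rewrite size_rev size_belast size_tuple.
exists (Tuple sz) => /=; rewrite -yE; apply/andP; split.
  by rewrite rev_path (@eq_path _ _ adj) // => a b /=; rewrite adj_sym.
case: (tval p) => [|a s] /=; first by rewrite eqxx.
by rewrite rev_cons last_rcons eqxx.
Qed.

Lemma dist_sym x y : dist x y = dist y x.
Proof. by apply: eq_find => k; apply: has_walk_sym. Qed.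

Definition square_adj (x y : G) : bool := (x != y) && (dist x y <= 2).

Lemma square_adj_sym : symmetric square_adj.
Proof. by move=> x y; rewrite /square_adj eq_sym dist_sym. Qed.

Lemma square_adj_irrefl : irreflexive square_adj.
Proof. by move=> x; rewrite /square_adj eqxx. Qed.

Definition square : sgraph := SGraph square_adj_sym square_adj_irrefl.

Definition del_adj (F : {set {set G}}) (x y : G) : bool :=
  adj x y && ([set x; y] \notin F).

Lemma del_adj_sym F : symmetric (del_adj F).
Proof. by move=> x y; rewrite /del_adj adj_sym setUC. Qed.

Lemma del_adj_irrefl F : irreflexive (del_adj F).
Proof. by move=> x; rewrite /del_adj adj_irrefl. Qed.

Definition del_edges (F : {set {set G}}) : sgraph :=
  SGraph (del_adj_sym F) (del_adj_irrefl F).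

End Graph.

Section CompleteGraph.
Variable n : nat.

Definition complete_adj (i j : 'I_n) : bool := i != j.

Lemma complete_adj_sym : symmetric complete_adj.
Proof. by move=> i j; rewrite /complete_adj eq_sym. Qed.

Lemma complete_adj_irrefl : irreflexive complete_adj.
Proof. by move=> i; rewrite /complete_adj eqxx. Qed.

Definition complete_graph : sgraph := SGraph complete_adj_sym complete_adj_irrefl.

End CompleteGraph.

Section CycleGraph.
Variable n : nat.

(* This is the n-cycle for n >= 3; the conjunct [i != j] only matters at
   n = 1. *)
Definition cycle_adj (i j : 'I_n) : bool :=
  (i != j) && ((i.+1 %% n == j) || (j.+1 %% n == i)).

Lemma cycle_adj_sym : symmetric cycle_adj.
Proof. by move=> i j; rewrite /cycle_adj eq_sym orbC. Qed.

Lemma cycle_adj_irrefl : irreflexive cycle_adj.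
Proof. by move=> i; rewrite /cycle_adj eqxx. Qed.

Definition cycle_graph : sgraph := SGraph cycle_adj_sym cycle_adj_irrefl.

End CycleGraph.

(* G has a (not necessarily induced) subgraph isomorphic to H. *)
Definition has_subgraph (H G : sgraph) : bool :=
  [exists f : {ffun H -> G}, injectiveb f &&
     [forall x, forall y, adj x y ==> adj (f x) (f y)]].

Definition triangle_free (G : sgraph) : bool :=
  ~~ has_subgraph (complete_graph 3) G.

Lemma triangle_free_del_all (G : sgraph) : triangle_free (del_edges (edges G)).
Proof.
apply/existsPn => f; apply/negP=> /andP[_ /forallP/(_ ord0)/forallP/(_ ord_max)].
move=> /implyP/(_ isT)/andP[/= fadj /negP[]].
by apply/imsetP; exists (f ord0, f ord_max).
Qed.

Lemma triangle_cover_ex (G : sgraph) :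
  exists m, [exists F : {set {set G}},
    [&& F \subset edges G, triangle_free (del_edges F) & #|F| == m]].
Proof.
exists #|edges G|; apply/existsP; exists (edges G).
by rewrite subxx triangle_free_del_all eqxx.
Qed.

Definition pi_T (G : sgraph) : nat := ex_minn (triangle_cover_ex G).

Section Orientation.
Variable G : sgraph.
Implicit Type D : {set G * G}.

(* (x, y) \in D is the arc from x to y. *)
Definition is_orientation D : bool :=
  [forall x, forall y,
    (((x, y) \in D) ==> adj x y) &&
    (adj x y ==> (((x, y) \in D) (+) ((y, x) \in D)))].

(* A directed cycle is a nonempty cyclic sequence of distinct vertices whose
   consecutive pairs are arcs; it has at most #|G| vertices. *)
Definition has_dicycle D : bool :=
  [exists k : 'I_#|G|, exists c : k.+1.-tuple G,
     ucycleb (fun x y => (x, y) \in D) c].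

Definition acyclic D : bool := ~~ has_dicycle D.

Definition acyclic_orientation D : bool := is_orientation D && acyclic D.

Definition reverse_arc D (a : G * G) : {set G * G} := (a.2, a.1) |: (D :\ a).

Definition dependent_arcs D : {set G * G} :=
  [set a in D | has_dicycle (reverse_arc D a)].

Definition num_dependent D : nat := #|dependent_arcs D|.

Lemma acyclic_orientation_ex : exists D, acyclic_orientation D.
Proof.
pose r (x : G) : nat := enum_rank x.
exists [set a : G * G | adj a.1 a.2 && (r a.1 < r a.2)].
apply/andP; split.
  apply/forallP=> x; apply/forallP=> y; rewrite !inE /= [adj y x]adj_sym.
  case: (boolP (adj x y)) => //= xy.
  case: ltngtP => // /ord_inj/enum_rank_inj exy.
  by rewrite exy adj_irrefl in xy.
apply/existsPn=> k; apply/existsPn=> c; apply/negP=> /andP[cc _].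
case: (tval c) (size_tuple c) cc => [|x s] //= _ xs.
have : path (relpre r ltn) x (rcons s x).
  by apply: sub_path xs => a b; rewrite inE /= => /andP[].
rewrite path_sortedE; last by move=> a b d; apply: ltn_trans.
by case/andP=> /allP/(_ x); rewrite mem_rcons inE eqxx /= ltnn => /(_ isT).
Qed.

Lemma num_dependent_ex :
  exists m, [exists D, acyclic_orientation D && (num_dependent D == m)].
Proof.
have [D hD] := acyclic_orientation_ex.
by exists (num_dependent D); apply/existsP; exists D; rewrite hD eqxx.
Qed.

Definition d_min : nat := ex_minn num_dependent_ex.

End Orientation.

(* Main.v *)
(** Write [F] for the set of edges underlying the dependent arcs of an acyclic
orientation, and [T_i] for the triangle [{i, i+1, i+2}]. The source-to-sink arc
of every triangle is dependent, so [F] meets every [T_i], as does the deleted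
set in [pi_T]. The chosen edges of [T_i] and [T_j] can only coincide if the
triangles are consecutive and the edge is [{i+1, i+2}]; hence a cover has at
least [n/2] edges, rounded up.

For an orientation, call [i] shared if [T_i] and [T_(i+1)] have the same
source-to-sink arc. If [i] and [i+2] are shared then the chords [(i+1, i+3)] and
[(i+3, i+5)] point the same way. A cover by source-to-sink arcs of minimum size
forces shared indices to alternate around the cycle, except at one place when
[n] is odd. For even [n] the chords close up to a directed cycle; for odd [n]
they form a directed path that makes dependent one more rim arc, which is the
source-to-sink arc of no triangle. So one additional dependent arc is needed.

It is enough, by an orientation with source [0] running up both sides of the
cycle: an arc [(x, y)] is not dependent as soon as some function increasing
along all arcs takes consecutive values at [x] and [y]. *)

Require Import Defs.
From mathcomp Require Import all_boot.
From mathcomp Require Import zify.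

Set Implicit Arguments.
Unset Strict Implicit.
Unset Printing Implicit Defensive.

(** * Counting with collisions, dicycles and dependent arcs *)

Lemma eq_set2 (T : finType) (a b c d : T) :
  [set a; b] = [set c; d] -> (a = c /\ b = d) \/ (a = d /\ b = c).
Proof.
move=> e; have := set21 a b; have := set22 a b; have := set21 c d; have := set22 c d.
rewrite e -{1 2}e !inE.
by do 4![case/orP=> /eqP ?]; subst; auto.
Qed.

Lemma card_imset_collisions (aT rT : finType) (f : aT -> rT) (A : {set aT}) :
  {in ~: A &, injective f} -> #|aT| <= #|f @: [set: aT]| + #|A|.
Proof.
move=> finj; rewrite -(cardsC A) addnC leq_add2r -(card_in_imset finj).
by apply/subset_leq_card/imsetS/subsetT.
Qed.

Lemma connect_converse (T : finType) (e : rel T) x y :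
  connect e x y -> connect [rel u v | e v u] y x.
Proof. by rewrite connect_rev. Qed.

Section Dicycle.
Variable G : sgraph.
Implicit Types (D : {set G * G}) (x y z : G).

Lemma has_dicycle_connect D x y :
  (x, y) \in D -> connect (fun u v => (u, v) \in D) y x -> has_dicycle D.
Proof.
move=> xy /connectP[p0 p0P xE]; case: (shortenP p0P) xE => p pP pU _ xE.
have sz : size p < #|G|.
  by rewrite -[(size p).+1]/(size (y :: p)) -(card_uniqP pU) max_card.
apply/existsP; exists (Ordinal sz); apply/existsP; exists (in_tuple (y :: p)).
by rewrite /ucycleb pU andbT /= rcons_path pP -xE.
Qed.

Lemma acyclic_rank D (r : G -> nat) :
  (forall x y, (x, y) \in D -> r x < r y) -> acyclic D.
Proof.
move=> rD; apply/existsPn=> k; apply/existsPn=> c; apply/negP=> /andP[cc _].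
case: (tval c) (size_tuple c) cc => [|x s] //= _ xs.
have : path (relpre r ltn) x (rcons s x) by apply: sub_path xs => a b /rD.
rewrite path_sortedE; last by move=> a b d; apply: ltn_trans.
by case/andP=> /allP/(_ x); rewrite mem_rcons inE eqxx /= ltnn => /(_ isT).
Qed.

Lemma dependent_connect D x y :
  (x, y) \in D -> connect (fun u v => (u, v) \in D :\ (x, y)) x y ->
  (x, y) \in dependent_arcs D.
Proof.
move=> xyD xy; rewrite inE xyD; apply: (@has_dicycle_connect _ y x).
  by rewrite !inE eqxx.
by apply: connect_sub xy => u v uv; apply: connect1; rewrite in_setU uv orbT.
Qed.

Lemma nondependent_rank D (r : G -> nat) x y :
  (forall u v, (u, v) \in D -> r u < r v) -> r y = (r x).+1 ->
  (x, y) \notin dependent_arcs D.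
Proof.
(* Tripling [r] leaves room to move [y] just below [x]. *)
move=> rD rxy; rewrite inE negb_and -/(acyclic _); apply/orP; right.
apply: (@acyclic_rank _ (fun v =>
  if v == x then 3 * r x + 2 else if v == y then 3 * r x + 1 else 3 * r v)).
have neq_yx : (y == x) = false by apply/eqP=> e; rewrite e in rxy; lia.
move=> u v; rewrite in_setU1 in_setD1 /= !xpair_eqE; case/orP.
  by case/andP=> /eqP-> /eqP->; rewrite eqxx neq_yx eqxx; lia.
case/andP=> nuv /rD ruv.
move: nuv; case: (u =P x) => [?|_]; case: (v =P x) => [?|_] //=; subst; rewrite ?neq_yx.
all: try (case: (u =P y) => [?|_]); try (case: (v =P y) => [?|_]) => //=; subst.
all: lia.
Qed.

End Dicycle.

Section Arc.
Variables (G : sgraph) (D : {set G * G}).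
Hypothesis hD : acyclic_orientation D.

(** [darc false] is the converse of [D], so one argument covers both directions of travel around the
    cycle. *)
Definition darc (t : bool) (x y : G) : bool :=
  if t then (x, y) \in D else (y, x) \in D.

Definition dependent_edges : {set {set G}} :=
  [set [set p.1; p.2] | p in dependent_arcs D].

Lemma card_dependent_edges : #|dependent_edges| <= num_dependent D.
Proof. exact: leq_imset_card. Qed.

Lemma darcN t x y : adj x y -> darc (~~ t) x y = ~~ darc t x y.
Proof.
case/andP: hD => /forallP/(_ x)/forallP/(_ y)/andP[_ /implyP h] _ /h.
by rewrite /darc; case: t => /=; do 2 case: (_ \in D).
Qed.

Lemma darc_sym t x y : darc (~~ t) x y = darc t y x.
Proof. by case: t. Qed.

Lemma darc_connect t x y : darc t x y -> connect (darc t) y x -> False.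
Proof.
case/andP: hD => _ /negP acy; case: t => xy yx; apply: acy.
  exact: has_dicycle_connect xy yx.
by apply: (has_dicycle_connect xy); apply: connect_converse yx.
Qed.

Lemma darc_dependent t x y : darc t x y ->
  connect (fun u v => darc t u v && ([set u; v] != [set x; y])) x y ->
  [set x; y] \in dependent_edges.
Proof.
case: t => xy con; apply/imsetP.
  exists (x, y) => //; apply: (dependent_connect xy).
  apply: connect_sub con => u v /andP[uv nuv]; apply: connect1.
  by rewrite !inE [X in _ && X]uv andbT; apply: contraNneq nuv => -[-> ->].
exists (y, x); last by rewrite setUC.
apply: (dependent_connect xy).
apply: connect_sub (connect_converse con) => u v /andP[uv nuv]; apply: connect1.
by rewrite !inE [X in _ && X]uv andbT; apply: contraNneq nuv => -[-> ->]; rewrite setUC.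
Qed.

(** The path through [z] survives the reversal because both its edges contain [z], which is not an
    end of the reversed arc. *)
Lemma transitive_dependent t x y z : x != z -> y != z ->
  darc t x y -> darc t x z -> darc t z y -> [set x; y] \in dependent_edges.
Proof.
move=> nxz nyz xy xz zy; apply: (darc_dependent xy).
have zn : z \notin [set x; y] by rewrite !inE negb_or ![z == _]eq_sym nxz.
by apply: (@connect_trans _ _ z); apply: connect1; rewrite (xz, zy) /=;
   apply: contraNneq zn => <-; rewrite !inE eqxx ?orbT.
Qed.

End Arc.

(** * Triangle covers of the square of a cycle *)

Definition shift (n k : nat) (i : 'I_n) : 'I_n :=
  Ordinal (ltn_pmod (i + k) (leq_ltn_trans (leq0n i) (ltn_ord i))).

Lemma shift_shift n a b (i : 'I_n) : shift a (shift b i) = shift (a + b) i.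
Proof. by apply: val_inj; rewrite /= modnDml -addnA (addnC b). Qed.

Lemma shift0 n (i : 'I_n) : shift 0 i = i.
Proof. by apply: val_inj; rewrite /= addn0 modn_small. Qed.

Lemma shiftn n (i : 'I_n) : shift n i = i.
Proof. by apply: val_inj; rewrite /= modnDr modn_small. Qed.

Lemma shift_inj n k : injective (@shift n k).
Proof.
move=> i j /(congr1 val) /= /eqP; rewrite eqn_modDr !modn_small // => /eqP.
exact: val_inj.
Qed.

Lemma val_shift n k (i : 'I_n) : k <= n ->
  shift k i = (if i + k < n then i + k else i + k - n) :> nat.
Proof.
move=> kn /=; have := ltn_ord i.
case: (ltnP (i + k) n) => [lt _|nle lin]; first exact: modn_small.
by rewrite -{1}(subnK nle) modnDr modn_small //; lia.
Qed.

(** Cyclic distance 1 or 2, with [+ n] for wrapping around, so that linear arithmetic decides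
    adjacency in the square. *)
Definition near (n i j : nat) : bool :=
  has (fun d => [|| j == i + d, i == j + d, j + d == i + n | i + d == j + n])
      [:: 1; 2].

Section CycleSquare.
Variables (n : nat) (hn : 7 <= n).
Let G := square (cycle_graph n).
Implicit Types i j : 'I_n.

Lemma cycle_adjE (i j : cycle_graph n) : adj i j = [|| j == i.+1 :> nat, i == j.+1 :> nat,
  (i == 0 :> nat) && (j == n.-1 :> nat) | (j == 0 :> nat) && (i == n.-1 :> nat)].
Proof.
have succ_mod (a : 'I_n) : a.+1 %% n = if a.+1 == n then 0 else a.+1.
  by case: eqP => [->|ne]; rewrite ?modnn // modn_small //; have := ltn_ord a; lia.
rewrite /adj /= /cycle_adj !succ_mod -val_eqE /=.
have := ltn_ord i; have := ltn_ord j; by do 2 case: ifP; lia.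
Qed.

Lemma dist_le2 (H : sgraph) (x y : H) : 1 < #|H| ->
  (dist x y <= 2) = [|| x == y, adj x y | [exists z, adj x z && adj z y]].
Proof.
move=> H1; have -> : adj x y = has_walk 1 x y.
  apply/idP/existsP => [xy|[p /andP[]]]; first by exists [tuple y]; rewrite /= xy eqxx.
  by case/tupleP: p => z p; rewrite tuple0 /= andbT => xz /eqP <-.
have -> : [exists z, adj x z && adj z y] = has_walk 2 x y.
  apply/existsP/existsP => [[z /andP[xz zy]]|[p]].
    by exists [tuple z; y]; rewrite /= xz zy eqxx.
  case/tupleP: p => z p; case/tupleP: p => w p; rewrite tuple0 /= andbT.
  by case/andP=> /andP[xz zw] /eqP <-; exists z; rewrite xz.
rewrite -has_walk0 /dist -[#|H|](subnK H1) addn2 /=.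
by do 3 case: ifP => //.
Qed.

Lemma adjE i j : @adj G i j = near n i j.
Proof.
rewrite /adj /= /square_adj dist_le2 ?card_ord; last by lia.
have hi := ltn_ord i; have hj := ltn_ord j.
have -> : [exists z, @adj (cycle_graph n) i z && adj z j] = 
   [|| i == j, j == i + 2 :> nat, i == j + 2 :> nat, j + 2 == i + n | i + 2 == j + n].
  apply/existsP/idP => [[z]|]; rewrite -?val_eqE.
    by rewrite !cycle_adjE /=; have := ltn_ord z; lia.
  (* The common neighbour is [i + 1] if [j] lies two steps ahead of [i]; otherwise [i] equals [j] or
     lies two steps ahead of it, and [j + 1] serves. *)
  case: (boolP ((j == i + 2 :> nat) || (i + 2 == j + n))) => ij ij'.
    exists (shift 1 i); rewrite !cycle_adjE val_shift; last lia.
    by case: ifP; move: ij ij' => /=; lia.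
  exists (shift 1 j); rewrite !cycle_adjE val_shift; last lia.
  by case: ifP; move: ij ij' => /=; lia.
rewrite cycle_adjE -!val_eqE /near /=; lia.
Qed.


Lemma adj_shift k i : 0 < k <= 2 -> @adj G i (shift k i).
Proof.
move=> hk; have := ltn_ord i; rewrite adjE val_shift /near /=; last lia.
by case: ifP; lia.
Qed.

(* The side of the triangle {i, i+1, i+2} opposite to the vertex i + c. *)
Definition side (i : 'I_n) (c : nat) : {set 'I_n} :=
  match c with
  | 0 => [set shift 1 i; shift 2 i]
  | 1 => [set i; shift 2 i]
  | _ => [set i; shift 1 i]
  end.

(** A chord is a side of only one triangle [T_i], a rim edge of two consecutive ones. The [minn] is
    there because [side] does not distinguish values from 2 on. *)
Lemma side_collision i j c d : side i c = side j d ->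
  [|| (i == j) && (minn c 2 == minn d 2), [&& j == shift 1 i, c == 0 & 1 < d]
    | [&& i == shift 1 j, d == 0 & 1 < c]].
Proof.
have := ltn_ord i; have := ltn_ord j.
by move: c d => [|[|c]] [|[|d]] hj hi /eq_set2[]
  [/(congr1 (@nat_of_ord n)) + /(congr1 (@nat_of_ord n))];
  rewrite -!(inj_eq (@ord_inj n)) !val_shift; try lia;
  rewrite /minn /=; do ?case: ifP; lia.
Qed.

(** [A] and its translate by -1 are disjoint and of equal size; the set counted is the complement of
    their union. *)
Lemma isolated_count (A : {set 'I_n}) : (forall i, i \in A -> shift 1 i \notin A) ->
  #|[set i | (i \notin A) && (shift 1 i \notin A)]| + #|A|.*2 = n.
Proof.
move=> hA; pose A1 := [set i | shift 1 i \in A].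
have cA1 : #|A1| = #|A|.
  rewrite -(card_imset (mem A1) (@shift_inj n 1)); apply: eq_card => i.
  apply/imsetP/idP => [[j + ->]|iA]; first by rewrite inE.
  have e : shift 1 (shift n.-1 i) = i by rewrite shift_shift add1n prednK ?shiftn //; lia.
  by exists (shift n.-1 i); rewrite // inE e.
have -> : [set i | (i \notin A) && (shift 1 i \notin A)] = ~: (A :|: A1).
  by apply/setP=> i; rewrite !inE negb_or.
have dA : [disjoint A & A1].
  by rewrite disjoint_subset; apply/subsetP=> i /hA; rewrite !inE.
rewrite -addnn -{2}cA1 -cardsUI (_ : A :&: A1 = set0) ?cards0 ?addn0.
  by rewrite addnC cardsC card_ord.
by apply/eqP; rewrite setI_eq0.
Qed.

(** The choices at [i] and [i + 1] both fall on the common side {i+1, i+2}. *)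
Definition shared (c : 'I_n -> nat) : {set 'I_n} :=
  [set i | (c i == 0) && (1 < c (shift 1 i))].

Lemma shared_sep c i : i \in shared c -> shift 1 i \notin shared c.
Proof. by rewrite !inE => /andP[_ c1]; rewrite negb_and -lt0n (ltnW c1). Qed.

Lemma sides_count c : n <= #|[set side i (c i) | i : 'I_n]| + #|shared c|.
Proof.
rewrite -[X in X <= _]card_ord.
have /card_imset_collisions : {in ~: shared c &, injective (fun i => side i (c i))}.
  move=> i j; rewrite !inE => hi hj /side_collision.
  case/or3P=> [/andP[/eqP //]|/and3P[/eqP e c0 c1]|/and3P[/eqP e c0 c1]].
    by rewrite -e c0 c1 in hi.
  by rewrite -e c0 c1 in hj.
by congr (_ <= _ + _); apply: eq_card => S; apply: (sameP imsetP);
   apply: (iffP imsetP) => -[i _ ->]; exists i.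
Qed.

Lemma triangle_cover_side (F : {set {set G}}) i :
  triangle_free (del_edges F) -> exists c, side i c \in F.
Proof.
move=> /negP tf; case: (boolP (side i 0 \in F)) => [|F0]; first by exists 0.
case: (boolP (side i 1 \in F)) => [|F1]; first by exists 1.
case: (boolP (side i 2 \in F)) => [|F2]; first by exists 2.
case: tf; apply/existsP; exists [ffun k : 'I_3 => shift k i : del_edges F].
have hi := ltn_ord i.
apply/andP; split.
  apply/injectiveP=> k l; rewrite !ffunE => /(congr1 (@nat_of_ord n)) e.
  apply/ord_inj; have hk := ltn_ord k; have hl := ltn_ord l.
  by move: e; rewrite !val_shift; try lia; do 2 case: ifP; lia.
apply/forallP=> k; apply/forallP=> l; apply/implyP=> /= nkl; rewrite !ffunE.
wlog lt_kl : k l nkl / k < l => [hw|].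
  case: (ltngtP k l) => [|lt_lk|/ord_inj e]; first exact: hw.
    by rewrite del_adj_sym; apply: hw => //; rewrite complete_adj_sym.
  by rewrite e complete_adj_irrefl in nkl.
apply/andP; split.
  have hl := ltn_ord l; rewrite adjE !val_shift; try lia.
  by do 2 case: ifP; rewrite /near /=; lia.
case: k l lt_kl {nkl} => [[|[|[|k]]] ?] [[|[|[|l]]] ?] //=; by rewrite ?shift0.
Qed.

(** With [s] shared indices at least [n - s] sides are distinct, and [2s <= n] since no two
    consecutive indices are shared. *)
Lemma cover_lower (F : {set {set G}}) :
  triangle_free (del_edges F) -> uphalf n <= #|F|.
Proof.
move=> tf; pose c i := xchoose (triangle_cover_side i tf).
have := sides_count c; have := isolated_count (@shared_sep c).
have : #|[set side i (c i) | i : 'I_n]| <= #|F|.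
  apply/subset_leq_card/subsetP=> _ /imsetP[i _ ->].
  exact: (xchooseP (triangle_cover_side i tf)).
lia.
Qed.

(** * A cover by [uphalf n] rim edges *)

Lemma double_lt (j : 'I_(uphalf n)) : j.*2 < n.
Proof. by have := ltn_ord j; lia. Qed.

(** The rim edges starting at even vertices; for odd [n] the last one is {n-1, 0}. *)
Definition even_sides : {set {set G}} :=
  [set side (Ordinal (double_lt j)) 2 | j : 'I_(uphalf n)].

Definition even_step (x y : nat) : bool :=
  ~~ odd x && ((y == x.+1) || (x.+1 == n) && (y == 0)).

Lemma even_step_side (x y : 'I_n) : even_step x y -> [set x; y] \in even_sides.
Proof.
move=> /andP[ev xy]; have hx := ltn_ord x; have hj : x./2 < uphalf n by lia.
apply/imsetP; exists (Ordinal hj) => //=.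
have -> : Ordinal (double_lt (Ordinal hj)) = x by apply: val_inj => /=; lia.
have -> // : y = shift 1 x; apply: ord_inj; rewrite val_shift; last lia.
have := ltn_ord y; case: ifP; lia.
Qed.

Lemma near_sorted x y : x < y < n ->
  near n x y = [|| y == x.+1, y == x.+2, y + 1 == x + n | y + 2 == x + n].
Proof. by rewrite /near /=; lia. Qed.

Lemma near_sym x y : near n x y = near n y x.
Proof. by rewrite /near /=; lia. Qed.

Lemma near_even_step_sorted x y z : x < y < z -> z < n ->
  near n x y -> near n y z -> near n x z ->
  [|| even_step x y, even_step y z, even_step x z | even_step z x].
Proof.
move=> /andP[xy yz] zn.
rewrite (@near_sorted x y) ?(@near_sorted y z) ?(@near_sorted x z) /even_step; last first.
1-3: lia.
move=> e1 e2 e3.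
(* Three pairwise near vertices are cyclically consecutive; this needs [n >= 7], since for [n = 6]
   the chords on 0, 2, 4 form a triangle too. The last two forms straddle 0. *)
have : [|| (y == x.+1) && (z == x.+2), [&& x == 0, y == 1 & z == n.-1]
  | [&& x == 0, y == n.-2 & z == n.-1]].
  by move: e1 e2 e3; do 3![case/or4P=> /eqP ?]; lia.
by clear e1 e2 e3; case/or3P; lia.
Qed.

Lemma near_even_step x y z : x < n -> y < n -> z < n ->
  near n x y -> near n y z -> near n x z ->
  [|| even_step x y, even_step y x, even_step y z, even_step z y, even_step x z
    | even_step z x].
Proof.
move=> xn yn zn; wlog xz : x z xn zn / x < z => [hw|].
  move=> nxy nyz nxz; case: (ltngtP x z) => [xz|zx|exz]; first exact: hw.
    rewrite near_sym in nxy; rewrite near_sym in nyz; rewrite near_sym in nxz.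
    by case/or4P: (hw z x zn xn zx nyz nxy nxz) => [||| /or3P[]] ->; rewrite ?orbT.
  by move: nxz; rewrite exz /near /=; lia.
wlog yz : x y z xn yn zn xz / y < z => [hw|].
  move=> nxy nyz nxz; case: (ltngtP y z) => [yz|zy|eyz]; first exact: hw.
    rewrite near_sym in nyz.
    have := hw x z y xn zn yn (ltn_trans xz zy) zy nxz nyz nxy.
    by case/or4P=> [||| /or3P[]] ->; rewrite ?orbT.
  by move: nyz; rewrite eyz /near /=; lia.
wlog xy : x y xn yn xz yz / x < y => [hw|].
  move=> nxy nyz nxz; case: (ltngtP x y) => [xy|yx|exy]; first exact: hw.
    rewrite near_sym in nxy.
    by case/or4P: (hw y x yn xn yz xz yx nxy nxz nyz) => [||| /or3P[]] ->; rewrite ?orbT.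
  by move: nxy; rewrite exy /near /=; lia.
have xyz : x < y < z by rewrite xy.
move=> nxy nyz nxz; have := near_even_step_sorted xyz zn nxy nyz nxz.
by case/or4P=> ->; rewrite ?orbT.
Qed.

Lemma even_sides_cover : triangle_free (del_edges even_sides).
Proof.
apply/existsPn=> f; apply/negP=> /andP[_ /forallP h].
have {}h (k l : 'I_3) : k != l -> near n (f k : 'I_n) (f l : 'I_n) /\
    ~ even_step (f k : 'I_n) (f l : 'I_n) /\ ~ even_step (f l : 'I_n) (f k : 'I_n).
  move=> kl; have /forallP/(_ l)/implyP/(_ kl)/andP[] := h k.
  rewrite adjE => -> nF; split=> //; split=> /even_step_side; apply/negP => //.
  by rewrite setUC.
pose b1 := @Ordinal 3 1 isT; pose b2 := @Ordinal 3 2 isT.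
have [n01 [s01 t01]] := h ord0 b1 isT.
have [n02 [s02 t02]] := h ord0 b2 isT.
have [n12 [s12 t12]] := h b1 b2 isT.
have := near_even_step (ltn_ord _) (ltn_ord _) (ltn_ord _) n01 n12 n02.
by do 5![case/orP => //].
Qed.

Lemma pi_T_cycle_square : pi_T G = uphalf n.
Proof.
rewrite /pi_T; case: ex_minnP => m /existsP[F /and3P[_ tf /eqP <-]] min_m.
apply/eqP; rewrite eqn_leq cover_lower // andbT.
apply: leq_trans (_ : #|even_sides| <= _); last first.
  by rewrite -[X in _ <= X]card_ord; apply: leq_imset_card.
apply: min_m; apply/existsP; exists even_sides.
rewrite even_sides_cover eqxx !andbT.
apply/subsetP=> _ /imsetP[j _ ->]; apply/imsetP.
exists (Ordinal (double_lt j), shift 1 (Ordinal (double_lt j))) => //.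
by rewrite inE; apply: adj_shift.
Qed.

End CycleSquare.

(** * The lower bound on dependent arcs *)

Section Lower.
Variables (n : nat) (hn : 7 <= n).
Let G := square (cycle_graph n).
Variable D : {set G * G}.
Hypothesis hD : acyclic_orientation D.
Implicit Type i : 'I_n.

Definition forward (k : nat) (i : 'I_n) : bool := darc D true i (shift k i).

Lemma darc_forward t k i : 0 < k <= 2 -> darc D t i (shift k i) = (forward k i == t).
Proof.
move=> hk; rewrite /forward; case: t; first by case: darc.
rewrite -[false]/(~~ true) (darcN hD) ?eqbF_neg //; exact: adj_shift.
Qed.

Lemma darc_backward t k i : 0 < k <= 2 -> darc D t (shift k i) i = (forward k i != t).
Proof.
by move=> hk; rewrite -darc_sym darc_forward //; case: t; case: forward.
Qed.

Lemma shift_neq k i : 0 < k < n -> shift k i != i.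
Proof.
move=> hk; have := ltn_ord i; rewrite -(inj_eq (@ord_inj n)) val_shift; last lia.
by case: ifP; lia.
Qed.

(* [i + middle i] is the vertex of {i, i+1, i+2} between the source and the
   sink, so [side i (middle i)] is the source-to-sink arc. *)
Definition middle (i : 'I_n) : nat :=
  if forward 1 i == forward 1 (shift 1 i) then 1
  else if forward 2 i == forward 1 i then 2 else 0.

Lemma side_middle_dependent i : side i (middle i) \in dependent_edges D.
Proof.
have s1 : shift 1 (shift 1 i) = shift 2 i := shift_shift 1 1 i.
have [n1 n2] : shift 1 i != i /\ shift 2 i != i by rewrite !shift_neq //; lia.
have n12 : shift 2 i != shift 1 i by rewrite -s1 shift_neq //; lia.
have [n1' n2' n12'] := And3 n1 n2 n12; rewrite eq_sym in n1'; rewrite eq_sym in n2'.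
rewrite eq_sym in n12'.
have b1 t : darc D t (shift 2 i) (shift 1 i) = (forward 1 (shift 1 i) != t).
  by rewrite -s1 darc_backward.
have f1 t : darc D t (shift 1 i) (shift 2 i) = (forward 1 (shift 1 i) == t).
  by rewrite -s1 darc_forward.
rewrite /middle; case: eqP => [e1|/eqP e1]; last case: eqP => [e2|/eqP e2] /=.
(* When the two rim arcs are in line, a chord running the other way would close a directed
   triangle. *)
- have e2 : forward 2 i = forward 1 i.
    case: (forward 2 i =P forward 1 i) => // /eqP e2; exfalso.
    apply: (@darc_connect _ _ hD (forward 1 i) (shift 2 i) i).
      by rewrite darc_backward.
    apply: (@connect_trans _ _ (shift 1 i)); apply: connect1.
      by rewrite darc_forward.
    by rewrite f1 e1.
  rewrite -[side i 1]/([set i; shift 2 i]).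
  apply: (@transitive_dependent G D (forward 1 i) _ _ (shift 1 i)) => //.
  + by rewrite darc_forward // e2.
  + by rewrite darc_forward.
  + by rewrite f1 e1.
- apply: (@transitive_dependent G D (forward 1 i) _ _ (shift 2 i)) => //.
  + by rewrite darc_forward.
  + by rewrite darc_forward // e2.
  + by rewrite b1 eq_sym.
- rewrite setUC; apply: (@transitive_dependent G D (forward 1 i) _ _ i) => //.
  + by rewrite b1 eq_sym.
  + by rewrite darc_backward.
  + by rewrite darc_forward.
Qed.

(** Neither middle value is 1, so the rim arcs at [i], [i + 1], [i + 2] alternate; the value 2 at
    [i + 1] aligns the chord there with its rim arc. *)
Lemma shared_middleP i : i \in shared middle ->
  [/\ forward 1 i = ~~ forward 1 (shift 1 i),
      forward 1 (shift 2 i) = ~~ forward 1 (shift 1 i)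
    & forward 2 (shift 1 i) = forward 1 (shift 1 i)].
Proof.
rewrite inE /middle !shift_shift.
case: (forward 1 i) (forward 1 (shift 1 i)) (forward 2 i) => [] [] [] //=;
by case: (forward 1 (shift (1 + 1) i)) (forward 2 (shift 1 i)) => [] [].
Qed.

Lemma shared_run i m : (forall j, j <= m -> shift j.*2 i \in shared middle) ->
  forall j, j <= m -> forward 1 (shift j.*2.+1 i) = forward 1 (shift 1 i).
Proof.
move=> sh; elim=> // j IH jm.
have [_ e _] := shared_middleP (sh j (ltnW jm)).
have [e' _ _] := shared_middleP (sh _ jm).
rewrite doubleS !shift_shift add1n in e e' *.
by apply: negb_inj; rewrite -e' e; rewrite -IH ?(ltnW jm).
Qed.

(** By [shared_run] the chords from [i + 1], [i + 3], ... all point the same way. The conjunct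
    [v == shift 2 u] records that the path uses chords only, so that it avoids any given rim
    edge. *)
Lemma shared_run_connect i m : (forall j, j <= m -> shift j.*2 i \in shared middle) ->
  connect (fun u v => darc D (forward 1 (shift 1 i)) u v && (v == shift 2 u))
    (shift 1 i) (shift m.*2.+3 i).
Proof.
move=> sh; set e := (fun u v => _).
have step j : j <= m -> e (shift j.*2.+1 i) (shift j.*2.+3 i).
  move=> jm; have [_ _] := shared_middleP (sh j jm); rewrite shift_shift add1n => e2.
  have -> : shift j.*2.+3 i = shift 2 (shift j.*2.+1 i) by rewrite shift_shift add2n.
  by rewrite /e darc_forward // eqxx andbT e2 (shared_run sh) // eqxx.
elim: m sh step => [|m IH] sh step; first exact/connect1/(step 0).
apply: connect_trans (connect1 (step m.+1 _)) => //.
by apply: IH => j jm; [apply: sh | apply: step]; apply: leqW.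
Qed.

(** * Alternation of shared indices around the cycle *)

Definition unshared : {set 'I_n} :=
  [set i | (i \notin shared middle) && (shift 1 i \notin shared middle)].

Lemma shared_alternate i m : i \in shared middle ->
  (forall j, j < m -> shift j.*2.+1 i \notin unshared) ->
  forall j, j <= m -> shift j.*2 i \in shared middle.
Proof.
move=> iA nB; elim=> [|j IH] jm; first by rewrite shift0.
have := nB j jm; have := shared_sep (IH (ltnW jm)).
rewrite !inE !shift_shift !add1n => /negPf -> /=.
by rewrite negbK.
Qed.

Lemma unshared_card_neq0 : #|unshared| <> 0.
Proof.
move=> B0; have := isolated_count hn (@shared_sep n middle).
rewrite -/unshared B0 add0n => cA.
have /card_gt0P[i iA] : 0 < #|shared middle| by lia.
have run : forall j, j <= n./2 -> shift j.*2 i \in shared middle.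
  by apply: shared_alternate => // j _; rewrite (cards0_eq B0) inE.
have [_ _] := shared_middleP (run 0 isT); rewrite shift0.
(* Starting at [i + 2], the chords lead from [i + 3] round to [i + 1 + n]; the chord {i+1, i+3}
   given by [i] itself then closes the cycle. *)
have run2 j : j <= (n./2).-2 -> shift j.*2 (shift 2 i) \in shared middle.
  by move=> jm; rewrite shift_shift addn2 -doubleS run //; lia.
have := shared_run_connect run2.
have -> : shift (n./2).-2.*2.+3 (shift 2 i) = shift 1 i.
  by rewrite shift_shift -{2}(shiftn i) shift_shift; congr (shift _ i); lia.
have e3 : forward 1 (shift 3 i) = forward 1 (shift 1 i).
  by apply: (shared_run run (j := 1)); lia.
rewrite !shift_shift add1n e3 => con e2.
apply: (@darc_connect G D hD (forward 1 (shift 1 i)) (shift 1 i) (shift 3 i)).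
  have -> : shift 3 i = shift 2 (shift 1 i) by rewrite shift_shift.
  by rewrite darc_forward // e2.
by apply: connect_sub con => u v /andP[uv _]; apply: connect1.
Qed.

Lemma chord_neq_rim i j : side i 1 != side j 2.
Proof. by apply/eqP=> /(side_collision hn); rewrite /= !andbF. Qed.

(** The shared indices are [b + 2], [b + 4], ..., [b + n - 1], so the chords lead from [b + 3] to
    [b + 2 + n], parallel to the rim arc between [b + 3] and [b + 2]. *)
Lemma exceptional_dependent m b : n = m.*2.+3 -> unshared = [set b] ->
  (side (shift 2 b) 2 \in dependent_edges D)
  && (side (shift 2 b) 2 \notin [set side i (middle i) | i : 'I_n]).
Proof.
move=> nm ub; have n_small k : 0 < k < m.*2.+3 -> 0 < k < n by rewrite nm.
have around k : shift (k + n) b = shift k b by rewrite -shift_shift shiftn.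
have bU : b \in unshared by rewrite ub inE.
have b1U : shift 1 b \notin unshared by rewrite ub inE shift_neq // n_small.
have b2A : shift 2 b \in shared middle.
  move: bU b1U; rewrite !inE => /andP[_ /negPf-> /=].
  by rewrite shift_shift negbK.
have run : forall j, j <= m -> shift j.*2 (shift 2 b) \in shared middle.
  apply: shared_alternate => // j jm; rewrite ub inE shift_shift shift_neq //.
  by apply: n_small; rewrite addn2 /= !ltnS ltn_double.
set t := forward 1 (shift 3 b).
have f2 : forward 1 (shift 2 b) = ~~ t.
  by have [e _ _] := shared_middleP b2A; rewrite e shift_shift.
have f1 : forward 1 (shift 1 b) = ~~ t.
  (* The last shared index is [b - 1] modulo [n], so its condition two places on concerns the rim
     arc at [b + 1]. *)
  have [_ + _] := shared_middleP (run m (leqnn m)).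
  rewrite [shift 1 _]shift_shift add1n (shared_run run) // !shift_shift.
  by rewrite -/t (_ : 2 + _ + 2 = 1 + n) ?around // [in RHS]nm addn2.
have := shared_run_connect run.
rewrite [shift _.+3 _]shift_shift -nm addnC around shift_shift -/t => con.
apply/andP; split.
  rewrite /side shift_shift setUC; apply: (@darc_dependent G D t).
    by rewrite -[shift 3 b](shift_shift 1 2) darc_backward // f2; move: (t) => [].
  apply: connect_sub con => u v /andP[uv /eqP ev]; apply: connect1; rewrite uv /= ev.
  have := chord_neq_rim u (shift 2 b).
  by rewrite /side shift_shift [in X in _ != X]setUC.
apply/imsetP=> -[i _] /(side_collision hn).
case/or3P=> [/andP[/eqP <-]|/and3P[_ //]|/and3P[/eqP e /eqP ci _]].
  by move: b2A; rewrite inE => /andP[/eqP ->].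
(* The only other triangle with this side is at [b + 1], where the rim arcs are in line, so that its
   middle value is 1. *)
have ei : i = shift 1 b by apply: (@shift_inj n 1); rewrite -e shift_shift.
by move: ci; rewrite ei /middle f1 shift_shift f2 eqxx.
Qed.

Lemma dependent_edges_lower : (uphalf n).+1 <= #|dependent_edges D|.
Proof.
pose E : {set {set G}} := [set side i (middle i) | i : 'I_n].
have subE : E \subset dependent_edges D.
  by apply/subsetP=> _ /imsetP[i _ ->]; apply: side_middle_dependent.
have leE := subset_leq_card subE.
have cE : n <= #|E| + #|shared middle| := sides_count hn middle.
have := isolated_count hn (@shared_sep n middle); rewrite -/unshared.
have nB0 := unshared_card_neq0.
(* With [u] unshared indices, twice [#|E|] is at least [n + u], and [u] has the parity of [n]; so
   [u >= 2] suffices by counting. *)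
have [cB1 cA|] := eqVneq #|unshared| 1; last lia.
have nm : n = (n./2).-1.*2.+3 by lia.
have /eqP/cards1P[b Bb] := cB1.
have /andP[eF eE] := exceptional_dependent nm Bb.
have : #|E|.+1 <= #|dependent_edges D|; last by clear -cE cA cB1; lia.
rewrite -add1n -[1]/(nat_of_bool true) -eE -cardsU1.
by apply/subset_leq_card; rewrite subUset sub1set eF.
Qed.

End Lower.

(** * An orientation attaining the bound *)

Section Upper.
Variables (n k : nat).
Hypotheses (hn : 7 <= n) (hk : k.*2 <= n <= k.*2.+1).
Let t := k.*2.-1.

(* The arcs increase from 0 along 2, 4, 6, ... and 1, 3, 5, ... up to t - 1, and
   from 0 backwards along n - 1, ..., t. The function [rank] has gap 1 on the
   arcs far from 0 and from t, [rank_source] near 0 and [rank_sink] near t. *)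
Definition rank (v : nat) : nat :=
  if v == 0 then 0 else if t <= v then n - v
  else if odd v then v./2 + 3 else v./2 + 1.

Definition rank_source (v : nat) : nat :=
  if v == 0 then 0 else if t <= v then n - v else if v == 1 then 2
  else if v == 2 then 1 else if odd v then v./2 + n else v./2 + 1.

Definition rank_sink (v : nat) : nat :=
  if v == 0 then 0 else if t <= v then k + t.-1 - v
  else if odd v then v./2 + n else v./2 + 1.

(** Below [t] each rim arc runs from its even to its odd end. From [t] on arcs descend, and the last
    clause is the chord across 0. *)
Definition up (x y : nat) : bool :=
  [|| (y == x + 2) && (y < t),
      [&& ~~ odd x, y == x + 1 & y < t],
      [&& odd y, x == y + 1 & x < t],
      [&& x == 0, n <= y + 2 & y < n],
      [&& t <= x, x < n & x == y + 1],
      [&& t <= x, x < n & x == y + 2]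
    | (x == n.-1) && (y == 1)].

Variant up_spec (x y : nat) : Prop :=
  | Up2 of y = x + 2 & y < t
  | UpOut of ~~ odd x & y = x + 1 & y < t
  | UpIn of odd y & x = y + 1 & x < t
  | UpZero of x = 0 & n <= y + 2 & y < n
  | UpTail1 of t <= x & x < n & x = y + 1
  | UpTail2 of t <= x & x < n & x = y + 2
  | UpLast of x = n.-1 & y = 1.

Lemma upP x y : reflect (up_spec x y) (up x y).
Proof.
apply: (iffP idP) => [|[]]; last first.
1-7: by rewrite /up; intros; subst; lia.
case/or4P=> [/andP[/eqP ? ?]|/and3P[? /eqP ? ?]|/and3P[? /eqP ? ?]|].
- exact: Up2.
- exact: UpOut.
- exact: UpIn.
case/or4P=> [/and3P[/eqP ? ? ?]|/and3P[? ? /eqP ?]|/and3P[? ? /eqP ?]|].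
- exact: UpZero.
- exact: UpTail1.
- exact: UpTail2.
by case/andP=> /eqP ? /eqP ?; exact: UpLast.
Qed.

Lemma up_rank x y : up x y -> rank x < rank y.
Proof. by rewrite /rank /t => /upP[]; rewrite /t; intros; do ?case: ifP; lia. Qed.

Lemma up_rank_source x y : up x y -> rank_source x < rank_source y.
Proof. by rewrite /rank_source /t => /upP[]; rewrite /t; intros; do ?case: ifP; lia. Qed.

Lemma up_rank_sink x y : up x y -> rank_sink x < rank_sink y.
Proof. by rewrite /rank_sink /t => /upP[]; rewrite /t; intros; do ?case: ifP; lia. Qed.

Lemma near_intro d x y : 0 < d <= 2 ->
  [|| y == x + d, x == y + d, y + d == x + n | x + d == y + n] -> near n x y.
Proof. by move=> hd e; apply/hasP; exists d => //; rewrite !inE; lia. Qed.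

Lemma up_near x y : up x y -> near n x y.
Proof.
case/upP=> [? ?|? ? ?|? ? ?|? ? ?|? ? ?|? ? ?|? ?].
- by apply: (@near_intro 2); lia.
- by apply: (@near_intro 1); lia.
- by apply: (@near_intro 1); lia.
- by apply: (@near_intro (n - y)); lia.
- by apply: (@near_intro 1); lia.
- by apply: (@near_intro 2); lia.
- by apply: (@near_intro 2); lia.
Qed.

Lemma near_up x y : x < n -> y < n -> near n x y -> up x y || up y x.
Proof.
wlog xy : x y / x < y => [hw xn yn nxy|].
  case: (ltngtP x y) => [xy|yx|exy]; first exact: hw.
    by rewrite orbC; apply: hw => //; rewrite near_sym.
  by move: nxy; rewrite exy /near /=; lia.
move=> xn yn; rewrite near_sorted ?xy // => /or4P[] /eqP e; apply/orP.
- have [yt|ty] := ltnP y t; last by right; apply/upP/UpTail1; lia.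
  have [ox|ex] := boolP (odd x); last by left; apply/upP/UpOut => //; lia.
  by right; apply/upP/UpIn => //; lia.
- have [yt|ty] := ltnP y t; last by right; apply/upP/UpTail2; lia.
  by left; apply/upP/Up2 => //; lia.
- by left; apply/upP/UpZero; lia.
have [x0|x1] := posnP x; first by left; apply/upP/UpZero; lia.
by right; apply/upP/UpLast; lia.
Qed.


(** The last alternative collects the arcs that none of the three functions certifies; they are
    listed in [gap_arcs]. *)
Lemma up_gap x y : y < n -> up x y ->
  [\/ rank y = (rank x).+1, rank_source y = (rank_source x).+1,
      rank_sink y = (rank_sink x).+1
   | [|| (x == 0) && ((y == 1) || (y == n - 2)), (t <= x) && (x == y + 2)
       | [&& ~~ odd x, 0 < x, x < t.-1 & y == x.+1]]].
Proof.
move=> yn /upP[? ?|ex ? ?|oy ? ?|? ? ?|? ? ?|? ? ?|? ?].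
(* [rank] has gap 2 on the chord from 0 to 2; [rank_source] puts 2 at height 1. *)
- have [e|x0] := eqVneq x 0.
    by constructor 2; rewrite /rank_source; do ?case: ifP; lia.
  by constructor 1; rewrite /rank; do ?case: ifP; lia.
- by constructor 4; lia.
- by constructor 1; rewrite /rank; do ?case: ifP; lia.
- have [e|ne] := eqVneq y (n - 2); first by constructor 4; lia.
  by constructor 2; rewrite /rank_source; do ?case: ifP; lia.
- by constructor 3; rewrite /rank_sink; do ?case: ifP; lia.
- by constructor 4; lia.
by constructor 2; rewrite /rank_source; do ?case: ifP; lia.
Qed.


Definition gap_arcs : seq (nat * nat) :=
  [:: (0, 1); (0, n - 2)] ++ [seq (x, x - 2) | x <- iota t (n - t)]
    ++ [seq (j.*2, j.*2.+1) | j <- iota 1 k.-2].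

(** The count is [2 + (n - t) + (k - 2) = n - k + 1], where [t = 2k - 1]. *)
Lemma size_gap_arcs : size gap_arcs = (uphalf n).+1.
Proof. by rewrite !size_cat !size_map !size_iota /= /t; lia. Qed.

Let G := square (cycle_graph n).

Definition up_orientation : {set G * G} :=
  [set a | up (a.1 : 'I_n) (a.2 : 'I_n)].

Lemma up_acyclic_orientation : acyclic_orientation up_orientation.
Proof.
apply/andP; split; last first.
  apply: (@acyclic_rank G up_orientation (fun v : 'I_n => rank v)) => x y.
  by rewrite inE => /up_rank.
apply/forallP=> x; apply/forallP=> y; rewrite !inE adjE //=.
apply/andP; split; apply/implyP; first exact: up_near.
move=> /(near_up (ltn_ord _) (ltn_ord _)).
case xy: (up (x : 'I_n) (y : 'I_n)); case yx: (up (y : 'I_n) (x : 'I_n)) => //.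
by have := ltn_trans (up_rank xy) (up_rank yx); rewrite ltnn.
Qed.

Lemma num_dependent_up : num_dependent up_orientation <= (uphalf n).+1.
Proof.
rewrite -size_gap_arcs /num_dependent cardE.
pose f (a : G * G) := (nat_of_ord (a.1 : 'I_n), nat_of_ord (a.2 : 'I_n)).
rewrite -(size_map f); apply: uniq_leq_size.
  rewrite map_inj_uniq ?enum_uniq // => -[x y] [x' y'] [] /ord_inj -> /ord_inj ->.
  by [].
move=> p /mapP[[x y]]; rewrite mem_enum => xy ->.
have xyU : up (x : 'I_n) (y : 'I_n) by move: xy; rewrite inE => /andP[]; rewrite inE.
have nogap (r : nat -> nat) : (forall u v, up u v -> r u < r v) ->
    r (y : 'I_n) = (r (x : 'I_n)).+1 -> False.
  move=> rD rxy; apply/negP: xy.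
  apply: (@nondependent_rank G up_orientation (fun v : 'I_n => r v)) rxy => u v.
  by rewrite inE => /rD.
have := ltn_ord (x : 'I_n) => xn.
case: (up_gap (ltn_ord _) xyU) => [/nogap[]|/nogap[]|/nogap[]|].
- exact: up_rank.
- exact: up_rank_source.
- exact: up_rank_sink.
rewrite /f /= /gap_arcs !mem_cat.
case/or3P=> [/andP[/eqP-> /orP[]/eqP->]|/andP[tx /eqP xy2]|/and4P[ex x0 xt /eqP yx]].
- by rewrite !inE.
- by rewrite !inE eqxx orbT.
- apply/orP; right; apply/orP; left; apply/mapP; exists (nat_of_ord (x : 'I_n)).
    by rewrite mem_iota; lia.
  by congr pair; lia.
- apply/orP; right; apply/orP; right; apply/mapP; exists (nat_of_ord (x : 'I_n))./2.
    by rewrite mem_iota; lia.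
  by congr pair; lia.
Qed.

End Upper.

Theorem theorem1 (n : nat) (hn : 7 <= n) :
  d_min (square (cycle_graph n)) = pi_T (square (cycle_graph n)) + 1.
Proof.
rewrite pi_T_cycle_square // addn1 /d_min.
case: ex_minnP => m /existsP[D /andP[hD /eqP <-]] min_m.
apply/eqP; rewrite eqn_leq; apply/andP; split; last first.
  exact: leq_trans (dependent_edges_lower hn hD) (card_dependent_edges D).
have hk : n./2.*2 <= n <= n./2.*2.+1 by lia.
apply: leq_trans (num_dependent_up hn hk).
apply: min_m; apply/existsP; exists (up_orientation n n./2).
by rewrite up_acyclic_orientation ?eqxx.
Qed.
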